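(* Let $A$ be a Banach lattice algebra with identity $e$, and let $A_e$ be the order ideal generated by $e$, equipped with the norm $\|x\|_e=\inf\{\lambda>0:|x|\le\lambda e\}$. Then: (i) $(A_e,\|\cdot\|_e)$, with the order and product of $A$, is a Banach lattice algebra which is lattice and algebra isometric to $C(K)$ (real continuous functions, pointwise operations, sup norm) for some compact Hausdorff space $K$; (ii) $A_e$ is a principal projection band in $A$, i.e. it is a band and $A=A_e\oplus A_e^{d}$, where $A_e^d=\{x\in A: |x|\wedge|y|=0\ \forall y\in A_e\}$; (iii) $A_e$ is an inverse closed subalgebra of $A$: if $a\in A_e$ is invertible in $A$ then $a^{-1}\in A_e$.
   Context: A Banach lattice algebra is a real Banach lattice $A$ with an associative bilinear product making $(A,\cdot)$ a Banach algebra ($\|xy\|\le\|x\|\|y\|$) such that $xy\ge0$ whenever $x,y\ge0$. It has identity $e$ if $e$ is a multiplicative identity with $\|e\|=1$ (such $e$ is positive). $A_e=\{x\in A:|x|\le\lambda e\text{ for some }\lambda\ge0\}$. *)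

(* Defs.v *)
From HB Require Import structures.
From mathcomp Require Import all_boot all_order all_algebra.
From mathcomp Require Import all_classical all_reals all_analysis.
Set Implicit Arguments. Unset Strict Implicit. Unset Printing Implicit Defensive.
Import Order.TTheory GRing.Theory Num.Theory numFieldNormedType.Exports.
Local Open Scope ring_scope.
Local Open Scope classical_set_scope.

Section BanachLatticeAlgebra.
Variables (R : realType) (V : lmodType R).
Variables (le : V -> V -> Prop) (join : V -> V -> V) (mul : V -> V -> V).

Definition vmeet (x y : V) : V := - join (- x) (- y).
Definition vabs (x : V) : V := join x (- x).

Definition vector_lattice : Prop :=
  [/\ [/\ (forall x, le x x),
          (forall x y, le x y -> le y x -> x = y) &
          (forall x y z, le x y -> le y z -> le x z)],
      (forall x y z, le x y -> le (x + z) (y + z)),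
      (forall (c : R) x y, 0 <= c -> le x y -> le (c *: x) (c *: y)) &
      (forall x y, [/\ le x (join x y), le y (join x y) &
                      forall z, le x z -> le y z -> le (join x y) z])].

Definition lattice_algebra : Prop :=
  [/\ [/\ (forall x y z, mul (x + y) z = mul x z + mul y z) &
          (forall x y z, mul x (y + z) = mul x y + mul x z)],
      (forall (c : R) x y, mul (c *: x) y = c *: mul x y),
      (forall (c : R) x y, mul x (c *: y) = c *: mul x y),
      (forall x y z, mul (mul x y) z = mul x (mul y z)) &
      (forall x y, le 0 x -> le 0 y -> le 0 (mul x y))].

Definition BLA_on (S : set V) (nrm : V -> R) : Prop :=
  [/\ [/\ S 0, (forall x y, S x -> S y -> S (x + y)),
          (forall (c : R) x, S x -> S (c *: x)),
          (forall x y, S x -> S y -> S (join x y)) &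
          (forall x y, S x -> S y -> S (mul x y))],
      [/\ (forall x, S x -> 0 <= nrm x),
          (forall x, S x -> nrm x = 0 -> x = 0),
          (forall (c : R) x, S x -> nrm (c *: x) = `|c| * nrm x) &
          (forall x y, S x -> S y -> nrm (x + y) <= nrm x + nrm y)],
      (forall x y, S x -> S y -> le (vabs x) (vabs y) -> nrm x <= nrm y),
      (forall x y, S x -> S y -> nrm (mul x y) <= nrm x * nrm y) &
      (forall u : nat -> V, (forall n, S (u n)) ->
         (forall eps : R, 0 < eps -> exists N : nat, forall m n : nat,
             (N <= m)%N -> (N <= n)%N -> nrm (u m - u n) < eps) ->
         exists2 x, S x & forall eps : R, 0 < eps ->
             exists N : nat, forall n : nat, (N <= n)%N -> nrm (u n - x) < eps)].

Definition has_identity (nrm : V -> R) (e : V) : Prop :=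
  [/\ (forall x, mul e x = x), (forall x, mul x e = x) & nrm e = 1].

Definition ideal_gen (e : V) : set V :=
  [set x | exists2 lam : R, 0 <= lam & le (vabs x) (lam *: e)].

Definition norm_e (e : V) (x : V) : R :=
  inf [set lam : R | 0 < lam /\ le (vabs x) (lam *: e)].

Definition disj_compl (S : set V) : set V :=
  [set x | forall y, S y -> vmeet (vabs x) (vabs y) = 0].

Definition is_band (S : set V) : Prop :=
  [/\ S 0, (forall x y, S x -> S y -> S (x + y)),
      (forall (c : R) x, S x -> S (c *: x)),
      (forall x y, S y -> le (vabs x) (vabs y) -> S x) &
      (forall (D : set V) (s : V), D `<=` S ->
         (forall d, D d -> le d s) ->
         (forall u, (forall d, D d -> le d u) -> le s u) -> S s)].

Definition CK_isometric (K : topologicalType) (S : set V) (nrm : V -> R)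
    (T : V -> K -> R) : Prop :=
  [/\ (forall x, S x -> continuous (T x)),
      (forall f : K -> R, continuous f -> exists2 x, S x & T x = f),
      (forall x y, S x -> S y -> T x = T y -> x = y),
      [/\ (forall x y, S x -> S y -> T (x + y) = (fun k => T x k + T y k)),
          (forall (c : R) x, S x -> T (c *: x) = (fun k => c * T x k)),
          (forall x y, S x -> S y ->
             T (join x y) = (fun k => Num.max (T x k) (T y k))),
          (forall x y, S x -> S y -> (le x y <-> forall k, T x k <= T y k)) &
          (forall x y, S x -> S y -> T (mul x y) = (fun k => T x k * T y k))] &
      (forall x, S x -> nrm x = sup (range (fun k => `|T x k|)))].

End BanachLatticeAlgebra.

(* Main.v *)
(** Since |e|^n has norm at most 1 and dominates e + n(|e| - e), the identity is
    positive.  Elements of A_e act on both sides like an f-algebra, and for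
    0 <= y in A_e, u = (y - d e)^+, one gets d u <= y u, which forces u = 0 when
    d > |y|.  Hence the norm of A and the order-unit norm coincide on A_e, so A_e
    is norm closed, and x /\ n e <= |x| e for every x >= 0 and every n: the
    sequence x /\ n e is eventually constant and its value is the component of x
    in A_e.  The band property and inverse closedness follow from this
    decomposition.

    For (i), K is the compact space of linear join-preserving functionals below
    p x = inf {l : P x <= l e}, P being the band projection onto A_e.  A minimal
    join-preserving sublinear functional is linear, which yields a functional in
    K attaining p at any given point; these functionals are multiplicative on
    A_e because their kernels are order ideals.  Surjectivity onto C(K) is the
    lattice form of Stone-Weierstrass together with completeness. *)

Require Import Defs.
From HB Require Import structures.
From mathcomp Require Import all_boot all_order all_algebra.
From mathcomp Require Import all_classical all_reals all_analysis.
From mathcomp Require Import lra.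
Import Order.TTheory GRing.Theory Num.Theory numFieldNormedType.Exports.
Local Open Scope ring_scope.
Local Open Scope classical_set_scope.

(** * Order and modulus calculus in vector lattices *)

Section VectorLattice.
Set Implicit Arguments.
Unset Strict Implicit.
Context {R : realType} {V : lmodType R} {le : V -> V -> Prop}
  {join : V -> V -> V}.
Hypothesis VL : vector_lattice le join.
Local Notation meet := (vmeet join).
Local Notation abs := (vabs join).

Lemma vle_refl x : le x x. Proof. by case: VL => -[]. Qed.
Lemma vle_anti x y : le x y -> le y x -> x = y.
Proof. by case: VL => -[_ + _] _ _ _; apply. Qed.
Lemma vle_trans y x z : le x y -> le y z -> le x z.
Proof. by case: VL => -[_ _ +] _ _ _; apply. Qed.
Lemma vleDr z x y : le x y -> le (x + z) (y + z).
Proof. by case: VL => _ + _ _; apply. Qed.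
Lemma vleZ (c : R) x y : 0 <= c -> le x y -> le (c *: x) (c *: y).
Proof. by case: VL => _ _ + _; apply. Qed.
Lemma vjoin_l x y : le x (join x y).
Proof. by case: VL => _ _ _ /(_ x y)[]. Qed.
Lemma vjoin_r x y : le y (join x y).
Proof. by case: VL => _ _ _ /(_ x y)[]. Qed.
Lemma vjoin_lub x y z : le x z -> le y z -> le (join x y) z.
Proof. by case: VL => _ _ _ /(_ x y)[_ _]; apply. Qed.

Lemma vleD a b c d : le a b -> le c d -> le (a + c) (b + d).
Proof.
move=> ab cd; apply: (@vle_trans (b + c)); first exact: vleDr.
by rewrite ![b + _]addrC; exact: vleDr.
Qed.

Lemma vle_subr x y z : le (x - y) z <-> le x (z + y).
Proof.
by split=> [/(vleDr y)|/(vleDr (- y))]; rewrite ?subrK ?addrK.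
Qed.

Lemma vle_subl x y z : le x (y - z) <-> le (x + z) y.
Proof.
by split=> [/(vleDr z)|/(vleDr (- z))]; rewrite ?subrK ?addrK.
Qed.

Lemma vsubr_ge0 x y : le 0 (y - x) <-> le x y.
Proof. by rewrite vle_subl add0r. Qed.

Lemma vleN x y : le x y -> le (- y) (- x).
Proof. by move=> xy; rewrite -vsubr_ge0 opprK addrC vsubr_ge0. Qed.

Lemma vle_addl x y : le 0 y -> le x (x + y).
Proof. by move=> y0; have := vleD (vle_refl x) y0; rewrite addr0. Qed.

Lemma vaddr_ge0 x y : le 0 x -> le 0 y -> le 0 (x + y).
Proof. by move=> x0 y0; rewrite -[0]addr0; exact: vleD. Qed.

Lemma vscale_ge0 (c : R) x : 0 <= c -> le 0 x -> le 0 (c *: x).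
Proof. by move=> c0 /(vleZ c0); rewrite scaler0. Qed.

Lemma vleZr (c d : R) x : c <= d -> le 0 x -> le (c *: x) (d *: x).
Proof.
by move=> cd x0; rewrite -vsubr_ge0 -scalerBl; apply: vscale_ge0; rewrite ?subr_ge0.
Qed.

Lemma vjoinC x y : join x y = join y x.
Proof.
by apply: vle_anti; apply: vjoin_lub; (exact: vjoin_l || exact: vjoin_r).
Qed.

Lemma vjoin_mono a b c d : le a b -> le c d -> le (join a c) (join b d).
Proof.
move=> ab cd; apply: vjoin_lub.
- exact: vle_trans ab (vjoin_l _ _).
- exact: vle_trans cd (vjoin_r _ _).
Qed.

Lemma vjoinDr x y z : join (x + z) (y + z) = join x y + z.
Proof.
apply: vle_anti.
  by apply: vjoin_lub; apply: vleDr; (exact: vjoin_l || exact: vjoin_r).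
rewrite -vle_subl; apply: vjoin_lub; rewrite vle_subl.
- exact: vjoin_l.
- exact: vjoin_r.
Qed.

Lemma vjoin_idPl x y : le y x -> join x y = x.
Proof.
move=> yx; apply: vle_anti; last exact: vjoin_l.
by apply: vjoin_lub => //; exact: vle_refl.
Qed.

Lemma vmeet_l x y : le (meet x y) x.
Proof. by rewrite -[X in le _ X]opprK; apply: vleN; exact: vjoin_l. Qed.
Lemma vmeet_r x y : le (meet x y) y.
Proof. by rewrite -[X in le _ X]opprK; apply: vleN; exact: vjoin_r. Qed.
Lemma vmeet_glb x y z : le z x -> le z y -> le z (meet x y).
Proof.
by move=> zx zy; rewrite -[z]opprK; apply: vleN; apply: vjoin_lub; apply: vleN.
Qed.

Lemma vmeetC x y : meet x y = meet y x.
Proof. by rewrite /vmeet vjoinC. Qed.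

Lemma vmeet_mono a b c d : le a b -> le c d -> le (meet a c) (meet b d).
Proof. by move=> ab cd; apply: vleN; apply: vjoin_mono; apply: vleN. Qed.

Lemma vmeet_ge0 x y : le 0 x -> le 0 y -> le 0 (meet x y).
Proof. exact: vmeet_glb. Qed.

Lemma vmeetDl x y z : meet (z + x) (z + y) = z + meet x y.
Proof. by rewrite /vmeet !opprD ![- z + _]addrC vjoinDr opprD opprK addrC. Qed.

(** Scaling a lower bound of [c *: x] and [c *: y] by [c^-1] gives a lower bound of [x] and [y]. *)
Lemma vmeetZ_le (c : R) x y : 0 < c ->
  le (meet (c *: x) (c *: y)) (c *: meet x y).
Proof.
move=> c0; set m := meet _ _.
have -> : m = c *: (c^-1 *: m) by rewrite scalerA divff ?scale1r ?gt_eqF.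
apply: vleZ (ltW c0) _; have ci0 : 0 <= c^-1 by rewrite invr_ge0 ltW.
apply: vmeet_glb.
- rewrite -[X in le _ X]scale1r -[X in le _ (X *: _)](mulVf (lt0r_neq0 c0)) -scalerA.
  by apply: vleZ => //; exact: vmeet_l.
- rewrite -[X in le _ X]scale1r -[X in le _ (X *: _)](mulVf (lt0r_neq0 c0)) -scalerA.
  by apply: vleZ => //; exact: vmeet_r.
Qed.

Lemma vsub_le x y : le 0 y -> le (x - y) x.
Proof. by move=> y0; rewrite vle_subr; exact: vle_addl. Qed.

(** With [m] the left side, [m - meet x z] is at most [x], and at most [y] because [m - y] lies
    below both [x] and [z]. *)
Lemma vmeetD_le x y z : le 0 x -> le 0 y -> le 0 z ->
  le (meet x (y + z)) (meet x y + meet x z).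
Proof.
move=> x0 y0 z0; rewrite -vle_subr; apply: vmeet_glb.
- exact: vle_trans (vsub_le _ (vmeet_ge0 x0 z0)) (vmeet_l _ _).
- rewrite vle_subr [y + meet x z]addrC -vle_subr; apply: vmeet_glb.
  + exact: vle_trans (vsub_le _ y0) (vmeet_l _ _).
  + by rewrite vle_subr [z + y]addrC; exact: vmeet_r.
Qed.

Lemma vmeet0_scale (c : R) x y : 0 <= c -> le 0 x -> le 0 y ->
  meet x y = 0 -> meet x (c *: y) = 0.
Proof.
(* The scalar [c + 1] is positive and dominates both [1] and [c], so [meet x (c *: y)] is at most
   [(c + 1) *: meet x y]. *)
move=> c0 x0 y0 xy; have d0 : 0 < c + 1 by rewrite ltr_wpDl.
apply: vle_anti; last exact: vmeet_ge0 (vscale_ge0 c0 y0).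
have := vmeetZ_le x y d0; rewrite xy scaler0 => h; apply: vle_trans _ h.
apply: vmeet_mono; last by apply: vleZr; rewrite ?lerDl.
by rewrite -[X in le X _]scale1r; apply: vleZr; rewrite ?lerDr.
Qed.

Lemma vabs_ge x : le x (abs x). Proof. exact: vjoin_l. Qed.
Lemma vabs_geN x : le (- x) (abs x). Proof. exact: vjoin_r. Qed.
Lemma vabs_le x y : le x y -> le (- x) y -> le (abs x) y.
Proof. exact: vjoin_lub. Qed.

Lemma vabsN x : abs (- x) = abs x.
Proof. by rewrite /vabs opprK vjoinC. Qed.

Lemma vhalf_ge0 x : le 0 (x + x) -> le 0 x.
Proof.
have h2 : (0 : R) <= 2^-1 by rewrite invr_ge0.
move/(vleZ h2).
by rewrite scaler0 -(mulr2n x) -(scaler_nat 2 x) scalerA mulVf ?scale1r ?pnatr_eq0.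
Qed.

Lemma vabs_ge0 x : le 0 (abs x).
Proof.
apply: vhalf_ge0; have := vleD (vabs_ge x) (vabs_geN x).
by rewrite subrr.
Qed.

Lemma vabs_id x : le 0 x -> abs x = x.
Proof.
move=> x0; apply: vjoin_idPl; apply: (@vle_trans 0) => //.
by rewrite -[X in le _ X]oppr0; exact: vleN.
Qed.

Lemma vabs0 : abs 0 = 0. Proof. exact: vabs_id (vle_refl _). Qed.

Lemma vabsD x y : le (abs (x + y)) (abs x + abs y).
Proof.
apply: vabs_le; first by apply: vleD; exact: vabs_ge.
by rewrite opprD; apply: vleD; exact: vabs_geN.
Qed.

Lemma vabsZ_le (c : R) x : le (abs (c *: x)) (`|c| *: abs x).
Proof.
wlog c0 : c x / 0 <= c => [hw|].
  have [/hw//|c0] := leP 0 c.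
  by rewrite -[c *: x]opprK -scalerN -scaleNr -normrN -(vabsN x); apply: hw;
     rewrite oppr_ge0 ltW.
rewrite ger0_norm //; apply: vabs_le; first by apply: vleZ => //; exact: vabs_ge.
by rewrite -scalerN; apply: vleZ => //; exact: vabs_geN.
Qed.

Lemma vabs_eq0 x : abs x = 0 -> x = 0.
Proof.
move=> x0; apply: vle_anti; first by rewrite -x0; exact: vabs_ge.
by have := vabs_geN x; rewrite x0 => /vleN; rewrite opprK oppr0.
Qed.

(** One side follows from [x <= |x - a| + a] and [y <= |y - b| + b], the other by exchanging the
    pairs. It later yields the join stability of the ideal and of the projection. *)
Lemma vabs_join_le x y a b :
  le (abs (join x y - join a b)) (abs (x - a) + abs (y - b)).
Proof.
have key x1 y1 a1 b1 :
    le (join x1 y1 - join a1 b1) (abs (x1 - a1) + abs (y1 - b1)).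
  rewrite vle_subr; apply: vjoin_lub.
    apply: vle_trans _ (vleD (vle_addl _ (vabs_ge0 (y1 - b1))) (vjoin_l a1 b1)).
    by rewrite -vle_subr; exact: vabs_ge.
  rewrite [abs _ + abs _]addrC.
  apply: vle_trans _ (vleD (vle_addl _ (vabs_ge0 (x1 - a1))) (vjoin_r a1 b1)).
  by rewrite -vle_subr; exact: vabs_ge.
apply: vabs_le; first exact: key.
by rewrite opprB -(vabsN (x - a)) -(vabsN (y - b)) !opprB.
Qed.

Definition vpos x := join x 0.

Lemma vpos_ge0 x : le 0 (vpos x). Proof. exact: vjoin_r. Qed.
Lemma vpos_ge x : le x (vpos x). Proof. exact: vjoin_l. Qed.

Lemma vposN x : vpos (- x) = vpos x - x.
Proof. by rewrite /vpos -vjoinDr subrr add0r vjoinC. Qed.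

Lemma vpos_decomp x : x = vpos x - vpos (- x).
Proof. by rewrite vposN subKr. Qed.

(** Since [vpos (- x) = vpos x - x], the meet is [vpos x + meet 0 (- x)], and
    [meet 0 (- x) = - vpos x]. *)
Lemma vpos_disj x : meet (vpos x) (vpos (- x)) = 0.
Proof.
rewrite vposN -{1}[vpos x]addr0 vmeetDl /vmeet oppr0 opprK vjoinC.
by rewrite subrr.
Qed.

Lemma vpos_le_abs x : le (vpos x) (abs x).
Proof. by apply: vjoin_lub; [exact: vabs_ge|exact: vabs_ge0]. Qed.

Lemma vdisj_solid x y z : meet (abs x) (abs z) = 0 -> le (abs y) (abs x) ->
  meet (abs y) (abs z) = 0.
Proof.
move=> xz yx; apply: vle_anti; last by apply: vmeet_ge0; exact: vabs_ge0.
by rewrite -xz; apply: vmeet_mono => //; exact: vle_refl.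
Qed.

Lemma vdisjD x y z : meet (abs x) (abs z) = 0 -> meet (abs y) (abs z) = 0 ->
  meet (abs (x + y)) (abs z) = 0.
Proof.
move=> xz yz; apply: vle_anti; last by apply: vmeet_ge0; exact: vabs_ge0.
have := vmeetD_le (vabs_ge0 z) (vabs_ge0 x) (vabs_ge0 y).
rewrite ![meet (abs z) _]vmeetC xz yz addr0 => h; apply: vle_trans _ h.
by apply: vmeet_mono (vle_refl _); exact: vabsD.
Qed.

Lemma vmeet_self x : meet x x = x.
Proof. by rewrite /vmeet vjoin_idPl ?opprK //; exact: vle_refl. Qed.

End VectorLattice.

Arguments vpos {R V} join x.

(** * A Hahn-Banach theorem for join-preserving functionals *)

Section JoinHahnBanach.
Set Implicit Arguments.
Unset Strict Implicit.
Context {R : realType} {V : lmodType R}.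
Variable join : V -> V -> V.
Hypothesis joinDr : forall x y z, join (x + z) (y + z) = join x y + z.

(** Preserving joins already at the sublinear stage makes the linear minimal elements lattice
    homomorphisms. Homogeneity is an inequality; its converse comes from [c^-1]. *)
Definition join_sublinear (q : V -> R) : Prop :=
  [/\ q 0 = 0, forall x y, q (x + y) <= q x + q y,
      forall c x, 0 < c -> q (c *: x) <= c * q x &
      forall x y, q (join x y) = Num.max (q x) (q y)].

Definition join_linear (phi : V -> R) : Prop :=
  [/\ forall x y, phi (x + y) = phi x + phi y,
      forall c x, phi (c *: x) = c * phi x &
      forall x y, phi (join x y) = Num.max (phi x) (phi y)].

Lemma join_sublinear_geN q x : join_sublinear q -> - q (- x) <= q x.
Proof.
by case=> q0 qD _ _; rewrite -subr_ge0 opprK -q0 -(subrr x); exact: qD.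
Qed.

(* Directedness of the family is what makes its infimum preserve joins. *)
Lemma inf_join_sublinear (I : Type) (D : set I) (q : I -> V -> R) (b : V -> R) :
  D !=set0 -> (forall i x, D i -> b x <= q i x) ->
  (forall i j, D i -> D j -> exists2 k, D k & forall x, q k x <= q i x /\ q k x <= q j x) ->
  (forall i, D i -> 0 <= q i 0) -> (exists2 i, D i & q i 0 <= 0) ->
  (forall i j x y, D i -> D j -> exists2 k, D k & q k (x + y) <= q i x + q j y) ->
  (forall i c x, D i -> 0 < c -> exists2 k, D k & q k (c *: x) <= c * q i x) ->
  (forall i x y, D i -> q i (join x y) = Num.max (q i x) (q i y)) ->
  join_sublinear (fun x => inf [set q i x | i in D]).
Proof.
move=> D0 qb qdir q0 [i0 Di0 qi0] qD qZ qJ.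
have hlb x : has_lbound [set q i x | i in D].
  by exists (b x) => _ [i Di <-]; exact: qb.
have hn x : [set q i x | i in D] !=set0 by case: D0 => i Di; exists (q i x), i.
have infle i x : D i -> inf [set q i x | i in D] <= q i x.
  by move=> Di; apply: ge_inf => //; exists i.
have leinf x m : (forall i, D i -> m <= q i x) -> m <= inf [set q i x | i in D].
  by move=> h; apply: lb_le_inf => // _ [i Di <-]; exact: h.
split.
- apply/eqP; rewrite eq_le leinf ?andbT //.
  by apply: le_trans qi0; exact: infle.
- move=> x y; rewrite -lerBlDr; apply: (@leinf) => i Di.
  rewrite lerBlDr -lerBlDl; apply: (@leinf) => j Dj.
  rewrite lerBlDl; have [k Dk] := qD i j x y Di Dj.
  by apply: le_trans; exact: infle.
- move=> c x c0; rewrite mulrC -ler_pdivrMr //; apply: (@leinf) => i Di.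
  rewrite ler_pdivrMr // mulrC; have [k Dk] := qZ i c x Di c0.
  by apply: le_trans; exact: infle.
- move=> x y; apply/eqP; rewrite eq_le; apply/andP; split; last first.
    rewrite ge_max; apply/andP; split; apply: (@leinf) => i Di;
      by apply: (le_trans (infle i _ Di)); rewrite qJ // le_max lexx ?orbT.
  apply/ler_addgt0Pr => eps eps0.
  have [_ [i Di <-] ix] := inf_adherent eps0 (conj (hn x) (hlb x)).
  have [_ [j Dj <-] jy] := inf_adherent eps0 (conj (hn y) (hlb y)).
  have [k Dk kij] := qdir _ _ Di Dj.
  apply: (le_trans (infle k _ Dk)); rewrite qJ // ge_max.
  apply/andP; split.
    apply: (le_trans (kij x).1); apply: (le_trans (ltW ix)).
    by rewrite lerD2r le_max lexx.
  apply: (le_trans (kij y).2); apply: (le_trans (ltW jy)).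
  by rewrite lerD2r le_max lexx orbT.
Qed.

(** The auxiliary functional of the Hahn-Banach argument: for sublinear [q] it lies below [q], and
    its value at [- y] is at most [- q y]. *)
Definition sublinear_shift (q : V -> R) (y : V) (x : V) : R :=
  inf [set q (x + t *: y) - t * q y | t in [set t | 0 <= t]].

Section Shift.
Variables (q : V -> R) (y : V).
Hypothesis jq : join_sublinear q.

Let qZ t : 0 <= t -> q (t *: y) <= t * q y.
Proof.
case: jq => q0 _ qZ _; rewrite le_eqVlt => /predU1P[<-|]; last exact: qZ.
by rewrite scale0r mul0r q0.
Qed.

(** Comes from [t * q y <= q (t *: y) <= q (x + t *: y) + q (- x)]; a bound free of [t] makes the
    infimum finite. *)
Let qb t x : 0 <= t -> - q (- x) <= q (x + t *: y) - t * q y.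
Proof.
move=> t0; case: jq => q0 qD qZ' _.
have [->|tn0] := eqVneq t 0.
  by rewrite scale0r addr0 mul0r subr0; exact: join_sublinear_geN.
have tp : 0 < t by rewrite lt_def tn0.
have h : t * q y <= q (t *: y).
  rewrite mulrC -ler_pdivlMr // mulrC.
  have := qZ' t^-1 (t *: y); rewrite invr_gt0 scalerA mulVf // scale1r; exact.
have := qD (x + t *: y) (- x); rewrite addrAC subrr add0r; lra.
Qed.

(** Subadditivity for [t *: y = (t - s) *: y + s *: y]. This monotonicity directs the family indexed
    by [t]. *)
Let anti s t x : 0 <= s -> s <= t ->
  q (x + t *: y) - t * q y <= q (x + s *: y) - s * q y.
Proof.
move=> s0 st; case: jq => q0 qD _ _.
rewrite -[in X in X <= _](subrK s t) scalerDl mulrDl.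
have h : q (x + ((t - s) *: y + s *: y)) <= (t - s) * q y + q (x + s *: y).
  rewrite addrCA (le_trans (qD _ _)) // lerD2r; apply: qZ.
  by rewrite subr_ge0.
by lra.
Qed.

Lemma sublinear_shift_le x : sublinear_shift q y x <= q x.
Proof.
apply: ge_inf.
  by exists (- q (- x)) => _ [t /= t0 <-]; exact: qb.
by exists 0 => //=; rewrite scale0r addr0 mul0r subr0.
Qed.

Lemma sublinear_shift_le1 x : sublinear_shift q y x <= q (x + y) - q y.
Proof.
apply: ge_inf.
  by exists (- q (- x)) => _ [t /= t0 <-]; exact: qb.
by exists 1 => //=; rewrite scale1r mul1r.
Qed.

(** Translation by [t *: y] commutes with joins, so every member of the family preserves them;
    [s + t] and [c * t] are the indices for sums and multiples. *)
Lemma sublinear_shift_join : join_sublinear (sublinear_shift q y).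
Proof.
case: (jq) => q0 qD qZ' qJ.
apply: (@inf_join_sublinear _ _ (fun t x => q (x + t *: y) - t * q y)
   (fun x => - q (- x))).
- by exists 0 => /=.
- by move=> t x /= t0; exact: qb.
- move=> s t /= s0 t0; exists (Num.max s t); first by rewrite /= le_max s0.
  by move=> x; split; apply: anti => //; rewrite le_max lexx ?orbT.
- by move=> t /= t0; have := qb 0 t0; rewrite oppr0 q0 oppr0.
- by exists 0; rewrite //= scale0r addr0 mul0r q0 subr0.
- move=> s t x z /= s0 t0; exists (s + t); first by rewrite /= addr_ge0.
  by rewrite scalerDl mulrDl opprD addrACA [leRHS]addrACA lerD2r.
- move=> t c x /= t0 c0; exists (c * t); first by rewrite /= mulr_ge0 // ltW.
  by rewrite -scalerA -scalerDr -mulrA mulrBr lerD2r qZ'.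
- move=> t x z /= t0; rewrite -joinDr qJ.
  by rewrite addr_maxl.
Qed.

End Shift.

(** Minimality forces [q] to equal its shift along [y], and the index [t = 1] then gives
    [q x <= q (x + y) - q y], the converse of subadditivity. *)
Lemma minimal_join_sublinear_linear q : join_sublinear q ->
  (forall r, join_sublinear r -> (forall x, r x <= q x) -> forall x, r x = q x) ->
  join_linear q.
Proof.
move=> jq qmin; case: (jq) => q0 qD qZ qJ.
have qA x y : q (x + y) = q x + q y.
  apply/eqP; rewrite eq_le qD /= -lerBrDr.
  rewrite -(qmin _ (sublinear_shift_join y jq) (sublinear_shift_le y jq)).
  exact: sublinear_shift_le1.
have qN x : q (- x) = - q x.
  by apply/eqP; rewrite -addr_eq0 -qA addNr q0.
have qP c x : 0 < c -> q (c *: x) = c * q x.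
  move=> c0; apply/eqP; rewrite eq_le qZ //=.
  rewrite mulrC -ler_pdivlMr // mulrC.
  have := qZ c^-1 (c *: x); rewrite invr_gt0 scalerA mulVf ?gt_eqF // scale1r.
  by apply.
split=> // c x; have [c0|c0|->] := ltgtP c 0; last by rewrite scale0r mul0r.
- apply: oppr_inj; rewrite -qN -scaleNr -mulNr; apply: qP.
  by rewrite oppr_gt0.
- exact: qP.
Qed.

Lemma exists_minimal_join_sublinear p : join_sublinear p ->
  exists2 q, join_linear q & forall x, q x <= p x.
Proof.
move=> jp.
pose T := {q : V -> R | join_sublinear q /\ forall x, q x <= p x}.
(* The order is reversed, so that a Zorn-maximal element is pointwise minimal; a nonempty chain is
   bounded by its pointwise infimum. *)
pose le (q r : T) := `[< forall x, sval r x <= sval q x >].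
have [|||F Fle|[q [jq qp]] qmax] := @Zorn T le.
- by move=> q; apply/asboolP.
- move=> r s t /asboolP rs /asboolP st; apply/asboolP => x.
  exact: le_trans (st x) (rs x).
- move=> [r rP] [s sP] /asboolP rs /asboolP sr; apply: eq_exist.
  by apply/funext => x; apply/eqP; rewrite eq_le sr rs.
- have [->|/set0P F0] := eqVneq F set0; first by exists (exist _ p (conj jp (fun=> lexx _))).
  have hb (i : T) x : F i -> - p (- x) <= sval i x.
    move=> _; case: i => i [ji ip] /=; apply: le_trans (join_sublinear_geN x ji).
    by rewrite lerN2.
  have jF : join_sublinear (fun x => inf [set sval i x | i in F]).
    apply: (inf_join_sublinear F0 hb).
    - move=> i j Fi Fj; have [/asboolP h|/asboolP h] := Fle _ _ Fi Fj.
        by exists j => // x; rewrite h lexx.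
      by exists i => // x; rewrite h lexx.
    - by move=> i _; case: (svalP i) => -[-> _ _ _] _.
    - by case: F0 => i Fi; exists i => //; case: (svalP i) => -[-> _ _ _] _.
    - move=> i j x y Fi Fj.
      have [/asboolP h|/asboolP h] := Fle _ _ Fi Fj.
        exists j => //; case: (svalP j) => -[_ jD _ _] _.
        by rewrite (le_trans (jD _ _)) // lerD2r.
      exists i => //; case: (svalP i) => -[_ jD _ _] _.
      by rewrite (le_trans (jD _ _)) // lerD2l.
    - by move=> i c x Fi c0; exists i => //; case: (svalP i) => -[_ _ iZ _] _; exact: iZ.
    - by move=> i x y Fi; case: (svalP i) => -[_ _ _ iJ] _; exact: iJ.
  have infle i x : F i -> inf [set sval i x | i in F] <= sval i x.
    move=> Fi; apply: ge_inf; last by exists i.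
    by exists (- p (- x)) => _ [j Fj <-]; exact: hb.
  have Fp x : inf [set sval i x | i in F] <= p x.
    case: F0 => i Fi; apply: (le_trans (infle i x Fi)).
    by case: (svalP i) => _; exact.
  exists (exist _ (fun x => inf [set sval i x | i in F]) (conj jF Fp) : T) => i Fi; apply/asboolP => x /=.
  exact: infle.
- exists q => //; apply: minimal_join_sublinear_linear => // r jr rq x.
  have rp z : r z <= p z by exact: le_trans (rq z) (qp z).
  have /(congr1 sval)/= -> // := qmax (exist _ r (conj jr rp) : T) (asboolT rq).
Qed.

(* A join-linear minorant of the shift of [p] at [x0] attains [p x0]. *)
Lemma join_hahn_banach p x0 : join_sublinear p ->
  exists phi, [/\ join_linear phi, forall x, phi x <= p x & phi x0 = p x0].
Proof.
move=> jp; have [phi phil phile] :=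
  exists_minimal_join_sublinear (sublinear_shift_join x0 jp).
have phip x : phi x <= p x.
  by apply: le_trans (phile x) _; exact: sublinear_shift_le.
exists phi; split=> //; apply/eqP; rewrite eq_le phip /=.
(* At [- x0] the shift is at most [p 0 - p x0], whence [phi (- x0) <= - p x0]. *)
have := le_trans (phile (- x0)) (sublinear_shift_le1 x0 jp (- x0)).
case: phil => phiD phiZ _; case: jp => p0 _ _ _.
by rewrite addNr p0 sub0r -scaleN1r phiZ mulN1r lerN2.
Qed.

End JoinHahnBanach.

(** * Compactness arguments and lattice Stone-Weierstrass *)

Section CompactSpaces.
Set Implicit Arguments.
Unset Strict Implicit.

(** Otherwise the complements of sets satisfying [P] form a proper filter; at a cluster point, a
    neighborhood satisfying [P] would meet its own complement. *)
Lemma compact_induction (K : topologicalType) (P : set K -> Prop) :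
  compact [set: K] -> P set0 ->
  (forall A B, P A -> P B -> P (A `|` B)) ->
  (forall A B, A `<=` B -> P B -> P A) ->
  (forall k : K, exists2 U : set K, nbhs k U & P U) -> P setT.
Proof.
move=> cK P0 PU PS Ploc; apply: contrapT => PT.
pose F : set_system K := [set A | P (~` A)].
have FF : ProperFilter F.
  split; first by rewrite /F /= setC0.
  split; rewrite /F /=.
  - by rewrite setCT.
  - by move=> A B PA PB; rewrite /= setCI; exact: PU.
  - by move=> A B AB; apply: PS; exact: subsetC.
have [k [_ Fk]] := cK F FF filterT.
have [U kU PU'] := Ploc k.
have FU : F (~` U) by rewrite /F /= setCK.
by have [x []] := Fk _ _ FU kU.
Qed.

(** Two passes of compactness: minima of interpolants through [s] stay below [f + eps], then maxima
    of these over varying [s] also stay above [f - eps]. *)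
Lemma lattice_stone_weierstrass (R : realType) (K : topologicalType)
    (L : set (K -> R)) (f : K -> R) :
  compact [set: K] -> continuous f -> L !=set0 ->
  (forall g, L g -> continuous g) ->
  (forall g h, L g -> L h -> L (g \max h)) ->
  (forall g h, L g -> L h -> L (g \min h)) ->
  (forall s t, exists g, [/\ L g, g s = f s & g t = f t]) ->
  forall eps, 0 < eps -> exists2 g, L g & forall k, `|g k - f k| < eps.
Proof.
move=> cK cf [g0 Lg0] cL Lmax Lmin Lint eps eps0.
have near_lt (g h : K -> R) k : continuous g -> continuous h -> g k < h k ->
    nbhs k [set x | g x < h x].
  move=> cg ch gh; pose m := (g k + h k) / 2.
  have gm : g k < m by rewrite /m; lra.
  have mh : m < h k by rewrite /m; lra.
  have kg : nbhs k [set x | g x < m] by exact: (cvgr_lt _ (cg k)).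
  have kh : nbhs k [set x | m < h x] by exact: (cvgr_gt _ (ch k)).
  by apply: filterS2 kg kh => x /= gx; exact: lt_trans.
have cfD e : continuous (fun k => f k + e).
  by move=> k; apply: cvgD; [exact: cf|exact: cvg_cst].
have upper s : exists g, [/\ L g, g s = f s & forall k, g k < f k + eps].
  pose P (U : set K) := exists g, [/\ L g, g s = f s & forall k, U k -> g k < f k + eps].
  suff [g [Lg gs gf]] : P setT by exists g; split=> // k; exact: gf.
  apply: (@compact_induction K P cK) => //.
  - by have [g [Lg gs _]] := Lint s s; exists g; split.
  - move=> A B [g [Lg gs gA]] [h [Lh hs hB]]; exists (g \min h); split.
    + exact: Lmin.
    + by rewrite /= gs hs minxx.
    + by move=> k [/gA|/hB] kf; rewrite gt_min kf ?orbT.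
  - by move=> A B AB [g [Lg gs gB]]; exists g; split=> // k /AB; exact: gB.
  - move=> t; have [g [Lg gs gt]] := Lint s t.
    exists [set k | g k < f k + eps]; last by exists g; split.
    by apply: near_lt; [exact: cL|exact: cfD|rewrite gt ltrDl].
(* On an empty space any member of [L] works; otherwise a point is needed to start the second pass
   at the empty set. *)
have [[s _]|K0] := pselect ([set: K] !=set0); last first.
  by exists g0 => // k; exfalso; apply: K0; exists k.
pose Q (U : set K) := exists g, [/\ L g, forall k, g k < f k + eps &
  forall k, U k -> f k + - eps < g k].
suff [g [Lg gu gl]] : Q setT.
  by exists g => // k; rewrite ltr_distlC; have := gu k; have := gl k I; lra.
apply: (@compact_induction K Q cK) => //.
- by have [g [Lg _ gu]] := upper s; exists g; split.
- move=> A B [g [Lg gu gA]] [h [Lh hu hB]]; exists (g \max h); split.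
  + exact: Lmax.
  + by move=> k; rewrite gt_max gu hu.
  + by move=> k [/gA|/hB] kf; rewrite lt_max kf ?orbT.
- by move=> A B AB [g [Lg gu gB]]; exists g; split=> // k /AB; exact: gB.
- move=> t; have [g [Lg gt gu]] := upper t.
  exists [set k | f k + - eps < g k]; last by exists g; split.
  by apply: near_lt; [exact: cfD|exact: cL|rewrite gt gtrDl oppr_lt0].
Qed.

Lemma compact_set_type (X : topologicalType) (A : set X) :
  compact A -> compact [set: A].
Proof.
move=> cA F FF _.
have FA : (set_val @ F) A.
  by apply: (filterE (F := F)) => a; exact: set_valP.
have [x [Ax Fx]] := cA _ _ FA.
exists (exist _ x (mem_set Ax)); split => //.
move=> B C FB [U [[W oW <-] Wx UC]].
have nW : nbhs x W by exact: open_nbhs_nbhs.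
have FvB : (set_val @ F) (set_val @` B).
  by apply: (filterS (F := F)) FB => b Bb; exists b.
have [_ [[b Bb <-] Wb]] := Fx _ _ FvB nW.
by exists b; split => //; exact: UC.
Qed.

Lemma hausdorff_set_type (X : topologicalType) (A : set X) :
  hausdorff_space X -> hausdorff_space A.
Proof.
move=> hX p q pq; apply: val_inj; apply: hX => U W pU qW.
have cv := @initial_continuous _ X (set_val : A -> X).
by have [a [Ua Wa]] := pq _ _ (cv p _ pU) (cv q _ qW); exists (set_val a).
Qed.

Lemma closed_eq_fun (R : realType) (X : topologicalType) (f g : X -> R) :
  continuous f -> continuous g -> closed [set x | f x = g x].
Proof.
move=> cf cg.
have -> : [set x | f x = g x] = (fun x => f x - g x) @^-1` [set 0].
  apply/seteqP; split=> x /=; first by move=> ->; rewrite subrr.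
  by move/eqP; rewrite subr_eq0 => /eqP.
apply: preimage_closed => // x _; exact: (cvgB (cf x) (cg x)).
Qed.

End CompactSpaces.

(** * The compact space of dominated lattice homomorphisms *)

Section JoinSpectrum.
Set Implicit Arguments.
Unset Strict Implicit.
Context {R : realType} {V : lmodType R}.
Variables (join : V -> V -> V) (p : V -> R).

(** The topology is that of pointwise convergence, and the bound [p] confines each value to a
    segment. *)
Definition join_spectrum : set {ptws V -> R} :=
  [set phi | join_linear join phi /\ forall x, phi x <= p x].

Let eval_continuous x : continuous (fun phi : {ptws V -> R} => phi x).
Proof. exact: (@proj_continuous V (fun=> R) x). Qed.

Lemma join_spectrum_closed : closed join_spectrum.
Proof.
have ev := eval_continuous.
have -> : join_spectrum =
    (\bigcap_(z in [set: V * V]) [set phi | phi (z.1 + z.2) = phi z.1 + phi z.2])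
    `&` (\bigcap_(z in [set: R * V]) [set phi | phi (z.1 *: z.2) = z.1 * phi z.2])
    `&` (\bigcap_(z in [set: V * V])
      [set phi | phi (join z.1 z.2) = Num.max (phi z.1) (phi z.2)])
    `&` (\bigcap_(x in [set: V]) [set phi | phi x <= p x]).
  apply/seteqP; split => [phi [[pD pZ pJ] pp]|phi [[[pD pZ] pJ] pp]].
    by split=> [|x _]; [split=> [|z _]; [split=> z _|]|] => /=.
  split=> [|x]; last exact: pp.
  split=> [x y|c x|x y].
  - exact: (pD (x, y)).
  - exact: (pZ (c, x)).
  - exact: (pJ (x, y)).
apply: closedI; first apply: closedI; first apply: closedI;
  apply: closed_bigI => z _.
- by apply: closed_eq_fun => // phi; exact: (cvgD (ev z.1 phi) (ev z.2 phi)).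
- apply: closed_eq_fun => // phi.
  exact: (cvgM (cvg_cst z.1) (ev z.2 phi)).
- apply: closed_eq_fun => // phi.
  exact: (continuous_max (ev z.1 phi) (ev z.2 phi)).
- apply: (@preimage_closed _ _ (fun phi : {ptws V -> R} => phi z) [set x | x <= p z]).
    by move=> phi _; exact: ev.
  exact: closed_le.
Qed.

(** A closed subset of the product of the segments from [- p (- x)] to [p x], compact by
    Tychonoff. *)
Lemma join_spectrum_compact : compact join_spectrum.
Proof.
apply: (subclosed_compact join_spectrum_closed
  (@tychonoff V (fun=> R) (fun x => `[- p (- x), p x]) _)).
  by move=> x; exact: segment_compact.
move=> phi [[pD pZ _] pp] x /=; rewrite in_itv /= pp andbT.
by have := pp (- x); rewrite -scaleN1r pZ; lra.
Qed.

Lemma join_spectrum_eval_continuous x :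
  continuous (fun k : join_spectrum => set_val k x).
Proof.
move=> k; apply: (@continuous_comp _ _ _ (set_val : join_spectrum -> {ptws V -> R})
  (fun phi => phi x)).
- exact: initial_continuous.
- exact: eval_continuous.
Qed.

Lemma join_spectrum_hausdorff : hausdorff_space join_spectrum.
Proof.
by apply: hausdorff_set_type; apply: hausdorff_product => _; exact: norm_hausdorff.
Qed.

End JoinSpectrum.

(** * Norm, order and product in a unital Banach lattice algebra *)

Section UnitalBanachLatticeAlgebra.
Set Implicit Arguments.
Unset Strict Implicit.
Context {R : realType} {A : normedModType R}.
Variables (le : A -> A -> Prop) (join : A -> A -> A) (mul : A -> A -> A) (e : A).
Hypotheses (VL : vector_lattice le join) (LA : lattice_algebra le mul)
  (BA : BLA_on le join mul setT (fun x : A => `|x|))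
  (IDe : has_identity mul (fun x : A => `|x|) e).
Local Notation meet := (vmeet join).
Local Notation abs := (vabs join).
Local Notation pos := (vpos join).
Local Notation Ae := (ideal_gen le join e).
Local Notation Aed := (disj_compl join Ae).
Local Notation norme := (norm_e le join e).

Lemma blaDl x y z : mul (x + y) z = mul x z + mul y z.
Proof. by case: LA => -[]. Qed.
Lemma blaDr x y z : mul x (y + z) = mul x y + mul x z.
Proof. by case: LA => -[]. Qed.
Lemma blaZl c x y : mul (c *: x) y = c *: mul x y.
Proof. by case: LA. Qed.
Lemma blaZr c x y : mul x (c *: y) = c *: mul x y.
Proof. by case: LA. Qed.
Lemma blaA x y z : mul (mul x y) z = mul x (mul y z).
Proof. by case: LA. Qed.
Lemma bla_ge0 x y : le 0 x -> le 0 y -> le 0 (mul x y).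
Proof. by case: LA => _ _ _ _; apply. Qed.
Lemma bla_el x : mul e x = x. Proof. by case: IDe. Qed.
Lemma bla_er x : mul x e = x. Proof. by case: IDe. Qed.
Lemma bla_norm_e : `|e| = 1. Proof. by case: IDe. Qed.
Lemma blaNl x y : mul (- x) y = - mul x y.
Proof. by rewrite -scaleN1r blaZl scaleN1r. Qed.
Lemma blaNr x y : mul x (- y) = - mul x y.
Proof. by rewrite -scaleN1r blaZr scaleN1r. Qed.
Lemma blaBl x y z : mul (x - y) z = mul x z - mul y z.
Proof. by rewrite blaDl blaNl. Qed.
Lemma blaBr x y z : mul x (y - z) = mul x y - mul x z.
Proof. by rewrite blaDr blaNr. Qed.
Lemma bla0r x : mul x 0 = 0.
Proof. by rewrite -[X in mul x X](scale0r (0 : A)) blaZr scale0r. Qed.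

Lemma bla_norm_abs_le x y : le (abs x) (abs y) -> `|x| <= `|y|.
Proof. by case: BA => _ _ h _ _; exact: (h x y I I). Qed.
Lemma bla_normM x y : `|mul x y| <= `|x| * `|y|.
Proof. by case: BA => _ _ _ h _; exact: (h x y I I). Qed.

Lemma bla_norm_le x y : le 0 x -> le x y -> `|x| <= `|y|.
Proof.
move=> x0 xy; apply: bla_norm_abs_le; rewrite !(vabs_id VL) //.
exact: (vle_trans VL) xy.
Qed.

Lemma bla_norm_abs x : `|abs x| = `|x|.
Proof.
by apply/eqP; rewrite eq_le !bla_norm_abs_le // (vabs_id VL (vabs_ge0 VL x));
  exact: (vle_refl VL).
Qed.

Lemma bla_mono x y z : le 0 z -> le x y -> le (mul z x) (mul z y).
Proof.
by move=> z0 xy; rewrite -(vsubr_ge0 VL) -blaBr; apply: bla_ge0 => //; rewrite (vsubr_ge0 VL).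
Qed.

Lemma bla_monol x y z : le 0 z -> le x y -> le (mul x z) (mul y z).
Proof.
by move=> z0 xy; rewrite -(vsubr_ge0 VL) -blaBl; apply: bla_ge0 => //; rewrite (vsubr_ge0 VL).
Qed.

(* The sum of (|x| - x)(|y| + y) and (|x| + x)(|y| - y) is 2(|x||y| - xy). *)
Lemma bla_abs_mul x y : le (abs (mul x y)) (mul (abs x) (abs y)).
Proof.
have key z t : le (mul z t) (mul (abs z) (abs t)).
  rewrite -(vsubr_ge0 VL); apply: (vhalf_ge0 VL).
  have geB w : le 0 (abs w - w) by rewrite (vsubr_ge0 VL); exact: (vabs_ge VL).
  have geD w : le 0 (abs w + w).
    by have := geB (- w); rewrite (vabsN VL) opprK.
  have := vaddr_ge0 VL (bla_ge0 (geB z) (geD t)) (bla_ge0 (geD z) (geB t)).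
  rewrite blaBl blaDl !blaDr !blaNr opprD !addrA.
  set a := mul (abs z) (abs t); set b := mul (abs z) t.
  set c := mul z (abs t); set d := mul z t.
  suff -> : a + b - c - d + a - b + c - d = a - d + a - d by [].
  by rewrite (ACl (1*4*5*8*(2*6)*(3*7)))%AC /= subrr addNr !addr0.
apply: (vabs_le VL); first exact: key.
by rewrite -blaNl -(vabsN VL x); exact: key.
Qed.

(* Writing |e| = e + g with g >= 0, the powers of |e| have norm at most 1 and
   dominate e + n g. *)
Lemma bla_unit_ge0 : le 0 e.
Proof.
(* [F n] is the n-th power of [|e|]. *)
pose f := abs e; pose g := f - e; pose F n := iter n (mul f) e.
have g0 : le 0 g by rewrite (vsubr_ge0 VL); exact: (vabs_ge VL).
have Fn n : `|F n| <= 1.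
  elim: n => [|n IH]; first by rewrite /= bla_norm_e.
  rewrite (le_trans (bla_normM _ _)) //.
  by rewrite bla_norm_abs bla_norm_e mul1r.
have Fge n : le (e + n%:R *: g) (F n).
  elim: n => [|n IH]; first by rewrite scale0r addr0; exact: (vle_refl VL).
  have -> : F n.+1 = F n + mul g (F n).
    by rewrite /F /= blaBl bla_el addrC subrK.
  have ng0 : le 0 (n%:R *: g) by apply: (vscale_ge0 VL).
  rewrite -natr1 scalerDl scale1r addrA; apply: (vleD VL) => //.
  rewrite -[X in le X _]bla_er; apply: bla_mono => //.
  exact: (vle_trans VL) (vle_addl VL _ ng0) IH.
(* Here [0 <= n g <= F n - e], and both [F n] and [e] have norm at most 1. *)
have gn n : n%:R * `|g| <= 2.
  have h : le (n%:R *: g) (F n - e).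
    by rewrite (vle_subl VL) addrC; exact: Fge.
  rewrite -[X in X * _]ger0_norm // -normrZ.
  apply: (le_trans (bla_norm_le _ h)); first exact: (vscale_ge0 VL).
  by rewrite (le_trans (ler_normB _ _)) // bla_norm_e; have := Fn n; lra.
have gz : g = 0.
  apply/eqP; rewrite -normr_eq0; apply/negP => /negP gn0.
  have gp : 0 < `|g| by rewrite lt_def gn0 /=.
  have := archi_boundP (divr_ge0 (ler0n R 2) (ltW gp)).
  by rewrite ltr_pdivrMr // ltNge gn.
by move/eqP: gz; rewrite subr_eq0 => /eqP <-; exact: (vabs_ge0 VL).
Qed.

Local Notation e0 := bla_unit_ge0.

(** From [z <= u] follows [vpos z <= abs u], so the norm of [vpos z] is at most every positive
    [eps]: the negative cone is closed. *)
Lemma vle0_limit z :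
  (forall eps, 0 < eps -> exists2 u, le z u & `|u| <= eps) -> le z 0.
Proof.
move=> h; suff pz : pos z = 0 by have := vpos_ge VL z; rewrite pz.
apply/eqP; rewrite -normr_le0; apply/ler_addgt0Pr => eps eps0; rewrite add0r.
have [u zu ueps] := h _ eps0; apply: le_trans ueps.
rewrite -(bla_norm_abs u); apply: bla_norm_le; first exact: (vpos_ge0 VL).
apply: (vjoin_lub VL); last exact: (vabs_ge0 VL).
exact: (vle_trans VL) zu (vabs_ge VL u).
Qed.

Lemma bla_norm_Ze c : `|c *: e| = `|c|.
Proof. by rewrite normrZ bla_norm_e mulr1. Qed.

Lemma bla_Ze_ge0 c : 0 <= c -> le 0 (c *: e).
Proof. by move=> c0; exact: (vscale_ge0 VL c0 e0). Qed.

Lemma vle_archimedean x l :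
  (forall eps, 0 < eps -> le x ((l + eps) *: e)) -> le x (l *: e).
Proof.
move=> h; rewrite -[X in le _ X]add0r -(vle_subr VL); apply: vle0_limit => eps eps0.
exists (eps *: e); last by rewrite bla_norm_Ze gtr0_norm.
by rewrite (vle_subr VL) -scalerDl addrC; exact: h.
Qed.

(** If [d < c] and [c *: e <= d *: e], then [(c - d) *: e] is both nonnegative and nonpositive,
    hence zero, although its norm is [c - d]. *)
Lemma bla_le_Ze c d : le (c *: e) (d *: e) <-> c <= d.
Proof.
split=> [h|cd]; last exact: (vleZr VL cd e0).
rewrite leNgt; apply/negP => dc.
have le0 : le ((c - d) *: e) 0 by rewrite scalerBl (vle_subr VL) add0r.
have ge0 : le 0 ((c - d) *: e) by apply: bla_Ze_ge0; rewrite subr_ge0 ltW.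
have := bla_norm_Ze (c - d); rewrite (vle_anti VL le0 ge0) normr0 => /esym/eqP.
by rewrite normr_eq0 subr_eq0 gt_eqF.
Qed.

(** * The order ideal generated by the identity *)

Lemma Ae_solid x y : Ae y -> le (abs x) (abs y) -> Ae x.
Proof. by move=> [l l0 yl] xy; exists l => //; exact: (vle_trans VL) yl. Qed.

Lemma Ae_pos_le x l : le 0 x -> le x (l *: e) -> Ae x.
Proof.
move=> x0 xl; exists l; last by rewrite (vabs_id VL).
by rewrite -bla_le_Ze scale0r; exact: (vle_trans VL) xl.
Qed.

Lemma AeZe c : Ae (c *: e).
Proof.
exists `|c|; first exact: normr_ge0.
by apply: (vle_trans VL) (vabsZ_le VL _ _) _; rewrite (vabs_id VL e0); exact: (vle_refl VL).
Qed.

Lemma Ae_e : Ae e. Proof. by rewrite -[e in X in Ae X]scale1r; exact: AeZe. Qed.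
Lemma Ae0 : Ae 0. Proof. by rewrite -(scale0r e); exact: AeZe. Qed.

Lemma Ae_abs x : Ae (abs x) <-> Ae x.
Proof. by rewrite /ideal_gen /= (vabs_id VL (vabs_ge0 VL x)). Qed.

Lemma AeD x y : Ae x -> Ae y -> Ae (x + y).
Proof.
move=> [l l0 xl] [m m0 ym]; exists (l + m); first exact: addr_ge0.
rewrite scalerDl; apply: (vle_trans VL) (vabsD VL _ _) _; exact: (vleD VL).
Qed.

Lemma AeZ c x : Ae x -> Ae (c *: x).
Proof.
move=> [l l0 xl]; exists (`|c| * l); first exact: mulr_ge0.
by apply: (vle_trans VL) (vabsZ_le VL _ _) _; rewrite -scalerA; exact: (vleZ VL).
Qed.

Lemma AeN x : Ae x -> Ae (- x).
Proof. by rewrite -scaleN1r; exact: AeZ. Qed.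

Lemma AeB x y : Ae x -> Ae y -> Ae (x - y).
Proof. by move=> ax ay; exact: AeD ax (AeN ay). Qed.

Lemma Ae_join x y : Ae x -> Ae y -> Ae (join x y).
Proof.
move=> ax ay; apply: (@Ae_solid _ (abs x + abs y)).
  by apply: AeD; rewrite Ae_abs.
rewrite [abs (_ + _)](vabs_id VL); last by apply: (vaddr_ge0 VL); exact: (vabs_ge0 VL).
by have := vabs_join_le VL x y 0 0; rewrite (vjoin_idPl VL (vle_refl VL 0)) !subr0.
Qed.

Lemma Ae_meet x y : Ae x -> Ae y -> Ae (meet x y).
Proof. by move=> ax ay; apply/AeN/Ae_join; exact: AeN. Qed.

Lemma AeM x y : Ae x -> Ae y -> Ae (mul x y).
Proof.
move=> [l l0 xl] [m m0 ym]; exists (l * m); first exact: mulr_ge0.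
apply: (vle_trans VL) (bla_abs_mul _ _) _.
apply: (vle_trans VL) (bla_mono (vabs_ge0 VL x) ym) _.
by rewrite blaZr bla_er mulrC -scalerA; exact: (vleZ VL).
Qed.

(* Multiplication by elements of [Ae] is dominated by scalar multiplication on
   both sides, hence annihilates disjoint pairs. *)
Lemma Ae_mul_disj u v : Ae u -> Ae v -> le 0 u -> le 0 v ->
  meet u v = 0 -> mul u v = 0.
Proof.
move=> [l l0 ul] [m m0 vm] u0 v0 uv.
rewrite (vabs_id VL u0) in ul; rewrite (vabs_id VL v0) in vm.
apply: (vle_anti VL); last exact: bla_ge0.
have vu := vmeet0_scale VL l0 u0 v0 uv.
have muv : le (mul u v) (m *: u).
  by have := bla_mono u0 vm; rewrite blaZr bla_er.
have luv : le (mul u v) (l *: v).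
  by have := bla_monol v0 ul; rewrite blaZl bla_el.
rewrite -(vmeet0_scale VL m0 (vscale_ge0 VL l0 v0) u0).
  exact: (vmeet_glb VL).
by rewrite (vmeetC VL).
Qed.

(* If [u := (y - d e)^+] then [d u <= y u], so [u = 0] as soon as [d > |y|]. *)
Lemma Ae_le_norm y : Ae y -> le 0 y -> le y (`|y| *: e).
Proof.
move=> ay y0; apply: vle_archimedean => eps eps0; set d := _ + eps.
pose z := y - d *: e; pose u := pos z; pose v := pos (- z).
have az : Ae z by apply: AeB => //; exact: AeZe.
have u0 : le 0 u := vpos_ge0 VL _.
have v0 : le 0 v := vpos_ge0 VL _.
have au : Ae u by apply: Ae_join => //; exact: Ae0.
have av : Ae v by apply: Ae_join; [exact: AeN|exact: Ae0].
have vu : mul v u = 0 by apply: Ae_mul_disj => //; rewrite (vmeetC VL); exact: (vpos_disj VL).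
have duy : le (d *: u) (mul y u).
  (* As [v u = 0], [z u = u u >= 0], which says [d u <= y u]. *)
  have zu : mul z u = mul u u by rewrite {1}(vpos_decomp VL z) blaBl -/v vu subr0.
  rewrite -(vsubr_ge0 VL).
  have -> : mul y u - d *: u = mul z u by rewrite /z blaBl blaZl bla_el.
  by rewrite zu; exact: bla_ge0.
have d0 : 0 <= d by rewrite addr_ge0 // ltW.
have := bla_norm_le (vscale_ge0 VL d0 u0) duy.
rewrite normrZ ger0_norm // => /le_trans/(_ (bla_normM _ _)) dn.
(* With [d = |y| + eps], the bound [d |u| <= |y| |u|] between norms leaves [eps |u| <= 0]. *)
have : `|u| <= 0.
  rewrite -(pmulr_rle0 _ eps0); move: dn; rewrite /d mulrDl.
  by rewrite gerDl.
rewrite normr_le0 => /eqP uz; have := vpos_ge VL z; rewrite -/u uz.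
by rewrite (vle_subr VL) add0r.
Qed.

(** * The order-unit norm and completeness of the ideal *)

Lemma Ae_abs_le_norm y : Ae y -> le (abs y) (`|y| *: e).
Proof.
by move=> ay; rewrite -(bla_norm_abs y); apply: Ae_le_norm; [rewrite Ae_abs|exact: (vabs_ge0 VL)].
Qed.

(** The norm of [x] plus [eps] is admissible, [eps] securing the strict positivity in [norm_e].
    Conversely an admissible [l] is the norm of [l *: e], which dominates [abs x]. *)
Lemma norm_eE x : Ae x -> norme x = `|x|.
Proof.
move=> ax; have lb0 : has_lbound [set l : R | 0 < l /\ le (abs x) (l *: e)].
  by exists 0 => l [/ltW].
apply/eqP; rewrite eq_le; apply/andP; split.
  apply/ler_addgt0Pr => eps eps0; apply: ge_inf => //; split.
    by rewrite ltr_wpDl.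
  apply: (vle_trans VL) (Ae_abs_le_norm ax) _.
  by rewrite bla_le_Ze lerDl ltW.
apply: lb_le_inf.
  case: ax => l l0 xl; exists (l + 1); split; first by rewrite ltr_wpDl.
  by apply: (vle_trans VL) xl _; rewrite bla_le_Ze lerDl.
move=> l [l0 xl]; rewrite -(bla_norm_abs x) -[l]gtr0_norm // -bla_norm_Ze.
exact: bla_norm_le (vabs_ge0 VL x) xl.
Qed.

(** Approximants [u] within distance 1 satisfy [abs u <= b] for one fixed multiple [b] of [e], so
    [abs x - b <= abs (u - x)], which has arbitrarily small norm. *)
Lemma Ae_closed x : (forall eps, 0 < eps -> exists2 u, Ae u & `|u - x| < eps) -> Ae x.
Proof.
move=> h; exists (`|x| + 1); first by rewrite addr_ge0.
rewrite -[X in le _ X]add0r -(vle_subr VL); apply: vle0_limit => eps eps0.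
have m0 : 0 < Num.min eps 1 by rewrite lt_min eps0 ltr01.
have [u au] := h _ m0; rewrite lt_min => /andP[ueps u1].
exists (abs (u - x)); last by rewrite bla_norm_abs ltW.
rewrite (vle_subr VL).
have -> : x = - (u - x) + u by rewrite opprB subrK.
apply: (vle_trans VL) (vabsD VL _ _) _; rewrite (vabsN VL) opprB subrK.
apply: (vleD VL); first exact: (vle_refl VL).
apply: (vle_trans VL) (Ae_abs_le_norm au) _; rewrite bla_le_Ze.
by rewrite -[u](subrK x) (le_trans (ler_normD _ _)) // addrC lerD2l ltW.
Qed.

(** By [norm_eE] the axioms are inherited from [A]; completeness uses that the ideal is norm
    closed. *)
Lemma BLA_on_Ae : BLA_on le join mul Ae norme.
Proof.
case: BA => _ [_ _ _ _] _ _ cplt; split.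
- split; [exact: Ae0|exact: AeD|exact: AeZ|exact: Ae_join|exact: AeM].
- split=> [x ax|x ax|c x ax|x y ax ay].
  + by rewrite norm_eE.
  + by rewrite norm_eE // => /eqP; rewrite normr_eq0 => /eqP.
  + by rewrite !norm_eE //; [exact: normrZ|exact: AeZ].
  + by rewrite !norm_eE //; [exact: ler_normD|exact: AeD].
- by move=> x y ax ay xy; rewrite !norm_eE //; exact: bla_norm_abs_le.
- by move=> x y ax ay; rewrite !norm_eE //; [exact: bla_normM|exact: AeM].
- move=> u au uc.
  have [] := cplt u (fun=> I).
    move=> eps /uc[N uN]; exists N => m n Nm Nn.
    by rewrite -norm_eE; [exact: uN|exact: AeB].
  move=> x _ ux; have ax : Ae x.
    apply: Ae_closed => eps /ux[N uN]; exists (u N) => //; exact: uN.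
  exists x => // eps /ux[N uN]; exists N => n Nn.
  by rewrite norm_eE; [exact: uN|exact: AeB].
Qed.

(** * The disjoint complement and the band projection *)

Lemma Aed_disj_e x : meet (abs x) e = 0 -> Aed x.
Proof.
move=> xe y [l l0 yl]; apply: (vle_anti VL); last first.
  by apply: (vmeet_ge0 VL); exact: (vabs_ge0 VL).
rewrite -(vmeet0_scale VL l0 (vabs_ge0 VL x) e0 xe).
by apply: (vmeet_mono VL) => //; exact: (vle_refl VL).
Qed.

Lemma AedD x y : Aed x -> Aed y -> Aed (x + y).
Proof. by move=> dx dy z az; apply: (vdisjD VL); [exact: dx|exact: dy]. Qed.

Lemma AedN x : Aed x -> Aed (- x).
Proof. by move=> dx z az; rewrite (vabsN VL); exact: dx. Qed.

Lemma AedB x y : Aed x -> Aed y -> Aed (x - y).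
Proof. by move=> dx dy; exact: AedD dx (AedN dy). Qed.

Lemma Aed_solid x y : Aed x -> le (abs y) (abs x) -> Aed y.
Proof. by move=> dx yx z az; apply: (vdisj_solid VL) yx; exact: dx. Qed.

Lemma AedZ c x : Aed x -> Aed (c *: x).
Proof.
move=> dx z az; apply: (vle_anti VL); last first.
  by apply: (vmeet_ge0 VL); exact: (vabs_ge0 VL).
rewrite -(vmeet0_scale VL (normr_ge0 c) (vabs_ge0 VL z) (vabs_ge0 VL x)).
  rewrite (vmeetC VL); apply: (vmeet_mono VL); first exact: (vle_refl VL).
  exact: (vabsZ_le VL).
by rewrite (vmeetC VL); exact: dx.
Qed.

Lemma Ae_Aed0 x : Ae x -> Aed x -> x = 0.
Proof.
by move=> ax /(_ _ ax); rewrite (vmeet_self VL); exact: (vabs_eq0 VL).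
Qed.

(* By [Ae_le_norm], [x /\ l e <= |x| e] for all [l], so [x /\ l e] is constant
   for [l >= |x|]. *)
Lemma Ae_decomp_pos x : le 0 x -> Ae (meet x (`|x| *: e)) /\ Aed (x - meet x (`|x| *: e)).
Proof.
move=> x0; have bound y l : le 0 y -> le y x -> le y (l *: e) -> le y (`|x| *: e).
  move=> y0 yx yl; have ay := Ae_pos_le y0 yl.
  apply: (vle_trans VL) (Ae_le_norm ay y0) _; rewrite bla_le_Ze.
  exact: bla_norm_le.
set w := meet _ _.
have w0 : le 0 w by apply: (vmeet_ge0 VL) => //; exact: bla_Ze_ge0.
split; first exact: Ae_pos_le w0 (vmeet_r VL _ _).
have xw0 : le 0 (x - w) by rewrite (vsubr_ge0 VL); exact: (vmeet_l VL).
apply: Aed_disj_e; rewrite (vabs_id VL) //.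
have m0 : le 0 (meet (x - w) e) by apply: (vmeet_ge0 VL) => //; exact: e0.
apply: (vle_anti VL) => //.
(* Adding [w] to the meet keeps it below [x] and below [(|x| + 1) *: e], hence by [bound] below
   [|x| *: e], and so below [w]. *)
rewrite -(subrr w) (vle_subl VL) addrC; apply: (vmeet_glb VL).
  rewrite addrC -(vle_subl VL); exact: (vmeet_l VL).
apply: (bound _ (`|x| + 1)).
- exact: (vaddr_ge0 VL).
- by rewrite addrC -(vle_subl VL); exact: (vmeet_l VL).
- rewrite scalerDl scale1r; apply: (vleD VL); exact: (vmeet_r VL).
Qed.

Lemma Ae_decomp x : exists a, Ae a /\ Aed (x - a).
Proof.
have [a1 d1] := Ae_decomp_pos (vpos_ge0 VL x).
have [a2 d2] := Ae_decomp_pos (vpos_ge0 VL (- x)).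
set p1 := meet _ _ in a1 d1; set p2 := meet _ _ in a2 d2.
exists (p1 - p2); split; first exact: AeB.
suff -> : x - (p1 - p2) = (pos x - p1) - (pos (- x) - p2) by exact: AedB.
by rewrite {1}(vpos_decomp VL x) !opprB addrACA [RHS]addrACA; congr (_ + _); exact: addrC.
Qed.

Lemma Ae_decomp_uniq x a b : Ae a -> Aed (x - a) -> Ae b -> Aed (x - b) -> a = b.
Proof.
move=> aa da ab db; apply/eqP; rewrite -subr_eq0; apply/eqP.
apply: Ae_Aed0; first exact: AeB.
suff -> : a - b = (x - b) - (x - a) by exact: AedB.
by rewrite opprB [RHS]addrC addrA subrK.
Qed.

Lemma Ae_direct_sum x :
  exists! p : A * A, [/\ Ae p.1, Aed p.2 & x = p.1 + p.2].
Proof.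
have [a [aa da]] := Ae_decomp x.
exists (a, x - a); split; first by split; rewrite //= addrC subrK.
move=> [b c] /= [ab dc xbc].
have xb : x - b = c by rewrite xbc addrC addKr.
have ba : a = b by apply: (Ae_decomp_uniq aa da ab); rewrite xb.
by rewrite -xb ba.
Qed.

(** Write [s = a + b] with [b] in [Aed]. Each [d] in [D] satisfies [d <= a], so [s <= a] and
    [b <= 0]; then [d - a <= b] gives [|b| <= |d - a|], and these two are disjoint. *)
Lemma Ae_band : is_band le join Ae.
Proof.
split; [exact: Ae0|exact: AeD|exact: AeZ|by move=> x y; exact: Ae_solid|].
move=> D s DA Ds sD; have [a [aa db]] := Ae_decomp s.
set b := s - a in db.
have aub d : D d -> le d a.
  move=> Dd; have ad : Ae (d - a) by apply: AeB => //; exact: DA.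
  suff pz : pos (d - a) = 0.
    by have := vpos_ge VL (d - a); rewrite pz (vle_subr VL) add0r.
  apply: (vle_anti VL); last exact: (vpos_ge0 VL).
  rewrite -(db _ ad); apply: (vmeet_glb VL); last exact: (vpos_le_abs VL).
  apply: (vle_trans VL) _ (vpos_le_abs VL b); apply: (vjoin_mono VL).
    by apply: (vleDr VL); exact: Ds.
  exact: (vle_refl VL).
have b0 : le b 0 by rewrite (vle_subr VL) add0r; exact: sD.
suff bz : b = 0 by move/eqP: bz; rewrite subr_eq0 => /eqP ->.
(* If [D] were empty, [s - e] would be an upper bound, forcing [e <= 0] and [e = 0]. *)
have [[d Dd]|D0] := pselect (D !=set0); last first.
  have := sD (s - e) (fun d Dd => False_ind _ (D0 (ex_intro _ d Dd))).
  rewrite (vle_subl VL) => /(vleDr VL (- s)); rewrite addrC addKr subrr => e_le0.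
  have := bla_norm_e; rewrite (vle_anti VL e_le0 e0) normr0 => /esym/eqP.
  by rewrite oner_eq0.
have ad : Ae (d - a) by apply: AeB => //; exact: DA.
apply: (vabs_eq0 VL); apply: (vle_anti VL); last exact: (vabs_ge0 VL).
rewrite -(db _ ad); apply: (vmeet_glb VL); first exact: (vle_refl VL).
have nb0 : le 0 (- b) by rewrite -oppr0; exact: (vleN VL).
rewrite -(vabsN VL b) (vabs_id VL nb0).
apply: (vle_trans VL) _ (vabs_geN VL _); apply: (vleN VL).
by apply: (vleDr VL); exact: Ds.
Qed.

(** Follows from [|a x| <= l |x|], as [Aed] is solid. *)
Lemma Aed_mul a x : Ae a -> Aed x -> Aed (mul a x).
Proof.
move=> [l l0 al] dx; apply: (@Aed_solid (l *: x)); first exact: AedZ.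
apply: (vle_trans VL) (bla_abs_mul _ _) _.
apply: (vle_trans VL) (bla_monol (vabs_ge0 VL x) al) _.
rewrite blaZl bla_el.
(* The bound [l |x| <= |l x|] is the homogeneity bound for [l^-1]; [l = 0] is treated apart. *)
have := vabsZ_le VL l^-1 (l *: x).
have [->|ln0] := eqVneq l 0; first by rewrite !scale0r (vabs0 VL) => _; exact: (vle_refl VL).
rewrite scalerA mulVf // scale1r => /(vleZ VL l0).
by rewrite scalerA ger0_norm ?invr_ge0 // divff // scale1r.
Qed.

(* Split [b = b1 + b2]; then [a b2 = e - a b1] lies in both [Ae] and [Aed]. *)
Lemma Ae_inverse_closed a b : Ae a -> mul a b = e -> mul b a = e -> Ae b.
Proof.
move=> aa ab ba; have [b1 [ab1 db2]] := Ae_decomp b.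
have ab2 : mul a (b - b1) = 0.
  apply: Ae_Aed0; last exact: Aed_mul.
  by rewrite blaBr ab; apply: AeB; [exact: Ae_e|exact: AeM].
have : b - b1 = 0 by rewrite -[LHS]bla_el -ba blaA ab2 bla0r.
by move/eqP; rewrite subr_eq0 => /eqP ->.
Qed.

(** Each identity follows from uniqueness of components. For joins, the remainder is dominated by
    [|x - P x| + |y - P y|], which lies in [Aed]. *)
Lemma Ae_proj_exists :
  exists P : A -> A, [/\ forall x, Ae (P x), forall x, Ae x -> P x = x,
    forall x y, P (x + y) = P x + P y, forall c x, P (c *: x) = c *: P x &
    forall x y, P (join x y) = join (P x) (P y)].
Proof.
have [P PP] := choice Ae_decomp.
have Puniq x a : Ae a -> Aed (x - a) -> P x = a.
  by case: (PP x) => ? ? ? ?; exact: (@Ae_decomp_uniq x).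
exists P; split.
- by move=> x; case: (PP x).
- move=> x ax; apply: Puniq => //; rewrite subrr => z _.
  rewrite (vabs0 VL); apply: (vle_anti VL); first exact: (vmeet_l VL).
  by apply: (vmeet_ge0 VL); [exact: (vle_refl VL)|exact: (vabs_ge0 VL)].
- move=> x y; have [[ax dx] [ay dy]] := (PP x, PP y).
  apply: Puniq; first exact: AeD.
  by rewrite opprD addrACA; exact: AedD.
- move=> c x; have [ax dx] := PP x; apply: Puniq; first exact: AeZ.
  by rewrite -scalerBr; exact: AedZ.
- move=> x y; have [[ax dx] [ay dy]] := (PP x, PP y).
  apply: Puniq; first exact: Ae_join.
  have dabs z : Aed z -> Aed (abs z).
    move=> dz; apply: (Aed_solid dz); rewrite (vabs_id VL (vabs_ge0 VL z)).
    exact: (vle_refl VL).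
  apply: (Aed_solid (AedD (dabs _ dx) (dabs _ dy))).
  rewrite [abs (_ + _)](vabs_id VL); first exact: (vabs_join_le VL).
  by apply: (vaddr_ge0 VL); exact: (vabs_ge0 VL).
Qed.

(** * The gauge that defines the spectrum *)

(** On [Ae] this will be the maximum over [K] of the representing function; it may be negative. *)
Definition vupper (x : A) : R := inf [set l | le x (l *: e)].

(** The infimum is attained because the order is Archimedean along [e], and finite because [x] lies
    above a multiple of [e]. *)
Lemma vupper_le x l : Ae x -> vupper x <= l <-> le x (l *: e).
Proof.
move=> ax; have lbx : has_lbound [set l | le x (l *: e)].
  exists (- `|x|) => m xm; rewrite -bla_le_Ze; apply: (vle_trans VL) xm.
  rewrite scaleNr -[X in le _ X]opprK; apply: (vleN VL).
  exact: (vle_trans VL) (vabs_geN VL x) (Ae_abs_le_norm ax).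
split=> [xl|xl]; last exact: ge_inf.
apply: vle_archimedean => eps eps0.
have nex : [set l | le x (l *: e)] !=set0.
  by exists `|x|; exact: (vle_trans VL) (vabs_ge VL x) (Ae_abs_le_norm ax).
have [m xm mlt] := inf_adherent eps0 (conj nex lbx).
apply: (vle_trans VL) xm _; rewrite bla_le_Ze (le_trans (ltW mlt)) //.
by rewrite lerD2r.
Qed.

Lemma vupperP x : Ae x -> le x (vupper x *: e).
Proof. by move=> ax; apply/(vupper_le _ ax). Qed.

(** Composition with [P] defines the gauge on all of [A], where the Hahn-Banach theorem applies. By
    [vupper_le] each clause becomes an inequality with multiples of [e]. *)
Lemma vupper_sublinear (P : A -> A) :
  (forall x, Ae (P x)) -> (forall x y, P (x + y) = P x + P y) ->
  (forall c x, P (c *: x) = c *: P x) ->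
  (forall x y, P (join x y) = join (P x) (P y)) ->
  join_sublinear join (vupper \o P).
Proof.
move=> aP PD PZ PJ; split => /=.
- have -> : P 0 = 0 by have := PZ 0 0; rewrite !scale0r.
  apply/eqP; rewrite eq_le; apply/andP; split.
    by apply/(vupper_le _ Ae0); rewrite scale0r; exact: (vle_refl VL).
  by rewrite -bla_le_Ze scale0r; exact: (vupperP Ae0).
- move=> x y; rewrite PD; apply/(vupper_le _ (AeD (aP x) (aP y))).
  by rewrite scalerDl; apply: (vleD VL); exact: vupperP.
- move=> c x c0; rewrite PZ; apply/(vupper_le _ (AeZ c (aP x))).
  by rewrite -scalerA; apply: (vleZ VL (ltW c0)); exact: vupperP.
- move=> x y; rewrite PJ; have aj := Ae_join (aP x) (aP y).
  apply/eqP; rewrite eq_le; apply/andP; split.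
    apply/(vupper_le _ aj); apply: (vjoin_lub VL).
      by apply/(vupper_le _ (aP x)); rewrite le_max lexx.
    by apply/(vupper_le _ (aP y)); rewrite le_max lexx orbT.
  rewrite ge_max; apply/andP; split.
    apply/(vupper_le _ (aP x)); exact: (vle_trans VL) (vjoin_l VL _ _) (vupperP aj).
  apply/(vupper_le _ (aP y)); exact: (vle_trans VL) (vjoin_r VL _ _) (vupperP aj).
Qed.

(** * Representation of the ideal on the spectrum *)

Section Representation.
Variable p : A -> R.
Hypothesis pJ : join_sublinear join p.
Hypothesis pE : forall x, Ae x -> p x = vupper x.
Hypothesis pK : forall x, exists2 a, Ae a & p (x - a) <= 0 /\ p (a - x) <= 0.
Local Notation K := (set_type (join_spectrum join p)).

(** The Gelfand transform, with lattice homomorphisms in place of characters. *)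
Definition gelfand (x : A) (k : K) : R := set_val k x.

Let gelfandP (k : K) : join_spectrum join p (set_val k) := set_valP k.

Lemma gelfandD x y k : gelfand (x + y) k = gelfand x k + gelfand y k.
Proof. by case: (gelfandP k) => -[h _ _] _; exact: h. Qed.
Lemma gelfandZ c x k : gelfand (c *: x) k = c * gelfand x k.
Proof. by case: (gelfandP k) => -[_ h _] _; exact: h. Qed.
Lemma gelfandJ x y k : gelfand (join x y) k = Num.max (gelfand x k) (gelfand y k).
Proof. by case: (gelfandP k) => -[_ _ h] _; exact: h. Qed.
Lemma gelfandN x k : gelfand (- x) k = - gelfand x k.
Proof. by rewrite -scaleN1r gelfandZ mulN1r. Qed.
Lemma gelfandB x y k : gelfand (x - y) k = gelfand x k - gelfand y k.
Proof. by rewrite gelfandD gelfandN. Qed.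
Lemma gelfand_meet x y k : gelfand (meet x y) k = Num.min (gelfand x k) (gelfand y k).
Proof. by rewrite /vmeet gelfandN gelfandJ !gelfandN oppr_max !opprK. Qed.
Lemma gelfand_abs x k : gelfand (abs x) k = `|gelfand x k|.
Proof. by rewrite /vabs gelfandJ gelfandN maxrN. Qed.

Lemma gelfand_le_vupper x k : Ae x -> gelfand x k <= vupper x.
Proof. by move=> ax; rewrite -pE //; case: (gelfandP k) => _; exact. Qed.

Lemma gelfand_attained x : Ae x -> exists k, gelfand x k = vupper x.
Proof.
move=> ax; have [phi [phil phip phix]] := join_hahn_banach (vjoinDr VL) x pJ.
exists (exist _ phi (mem_set (conj phil phip))).
by rewrite -pE.
Qed.

Lemma gelfand_mono x y k : Ae x -> Ae y -> le x y -> gelfand x k <= gelfand y k.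
Proof.
move=> ax ay xy; rewrite -subr_le0 -gelfandB.
apply: (le_trans (gelfand_le_vupper k (AeB ax ay))).
by apply/(vupper_le _ (AeB ax ay)); rewrite scale0r (vle_subr VL) add0r.
Qed.

(** For the converse, the gauge of [x - y] is attained at some point of [K], where it is
    nonpositive. *)
Lemma gelfand_le x y : Ae x -> Ae y ->
  le x y <-> forall k, gelfand x k <= gelfand y k.
Proof.
move=> ax ay; split=> [xy k|xy]; first exact: gelfand_mono.
have axy := AeB ax ay; have [k kxy] := gelfand_attained axy.
have : vupper (x - y) <= 0 by rewrite -kxy gelfandB subr_le0.
by move/(vupper_le _ axy); rewrite scale0r (vle_subr VL) add0r.
Qed.

Lemma gelfand_e k : gelfand e k = 1.
Proof.
apply/eqP; rewrite eq_le; apply/andP; split.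
  apply: (le_trans (gelfand_le_vupper k Ae_e)); apply/(vupper_le _ Ae_e).
  by rewrite scale1r; exact: (vle_refl VL).
rewrite -lerN2 -gelfandN; have an := AeN Ae_e.
apply: (le_trans (gelfand_le_vupper k an)); apply/(vupper_le _ an).
by rewrite scaleN1r; exact: (vle_refl VL).
Qed.

(** By [pK], each [x] has a companion [a] in [Ae] at which every functional dominated by [p] takes
    the same value. *)
Lemma gelfand_inj_Ae s t :
  (forall x, Ae x -> gelfand x s = gelfand x t) -> s = t.
Proof.
move=> st; apply: val_inj; apply/funext => x; have [a aa [xa ax]] := pK x.
have ev k : gelfand x k = gelfand a k.
  case: (gelfandP k) => _ kp; apply/eqP; rewrite eq_le; apply/andP.
  by split; rewrite -subr_le0 -gelfandB;
    [exact: le_trans (kp _) xa|exact: le_trans (kp _) ax].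
by have := st a aa; rewrite -!ev.
Qed.

Lemma gelfand_le_norm x k : Ae x -> `|gelfand x k| <= `|x|.
Proof.
move=> ax; rewrite -gelfand_abs.
apply: (le_trans (gelfand_mono k _ _ (Ae_abs_le_norm ax))).
- by rewrite Ae_abs.
- exact: AeZe.
- by rewrite gelfandZ gelfand_e mulr1.
Qed.

(* The kernel of [k] is an order ideal, hence an algebra ideal of [Ae]. *)
Lemma gelfandM x y k : Ae x -> Ae y ->
  gelfand (mul x y) k = gelfand x k * gelfand y k.
Proof.
move=> ax ay.
have ker z : Ae z -> gelfand z k = 0 -> gelfand (mul z y) k = 0.
  move=> az kz; apply/eqP; rewrite -normr_le0 -gelfand_abs.
  have le1 : le (abs (mul z y)) (`|y| *: abs z).
    apply: (vle_trans VL) (bla_abs_mul _ _) _.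
    have := bla_mono (vabs_ge0 VL z) (Ae_abs_le_norm ay).
    by rewrite blaZr bla_er.
  apply: (le_trans (gelfand_mono k _ _ le1)).
  - by rewrite Ae_abs; exact: AeM.
  - by apply: AeZ; rewrite Ae_abs.
  - by rewrite gelfandZ gelfand_abs kz normr0 mulr0.
have az : Ae (x - gelfand x k *: e) by apply: AeB => //; exact: AeZe.
have /(ker _ az) : gelfand (x - gelfand x k *: e) k = 0.
  by rewrite gelfandB gelfandZ gelfand_e mulr1 subrr.
rewrite blaBl blaZl bla_el gelfandB gelfandZ => /eqP.
by rewrite subr_eq0 => /eqP.
Qed.

(** At a point where the gauge of [abs x] is attained, [abs x] lies below that value times [e]. *)
Lemma gelfand_norm_attained x : Ae x -> exists k, `|x| <= `|gelfand x k|.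
Proof.
move=> ax; have aax : Ae (abs x) by rewrite Ae_abs.
have [k kx] := gelfand_attained aax; exists k.
rewrite -(bla_norm_abs x).
apply: (le_trans (bla_norm_le (vabs_ge0 VL x) (vupperP aax))).
by rewrite bla_norm_Ze -kx gelfand_abs normr_id.
Qed.

Lemma gelfand_norm x : Ae x -> `|x| = sup (range (fun k => `|gelfand x k|)).
Proof.
move=> ax; have [k xk] := gelfand_norm_attained ax.
have ub : ubound (range (fun k => `|gelfand x k|)) `|x|.
  by move=> _ [h _ <-]; exact: gelfand_le_norm.
apply/eqP; rewrite eq_le; apply/andP; split; last first.
  by apply: ge_sup => //; exists `|gelfand x k|, k.
apply: (le_trans xk).
by apply: ub_le_sup; [exists (`|x|)|exists k].
Qed.

Lemma gelfand_continuous x : continuous (gelfand x : K -> R).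
Proof. exact: join_spectrum_eval_continuous. Qed.

Lemma gelfand_dense (f : K -> R) : continuous f ->
  forall eps, 0 < eps -> exists2 x, Ae x & forall k, `|gelfand x k - f k| < eps.
Proof.
move=> cf eps eps0.
have cK : compact [set: K] := compact_set_type (@join_spectrum_compact R A join p).
pose L : set (K -> R) := [set g | exists2 x, Ae x & g = gelfand x].
have [|||||g [x ax ->] h] := @lattice_stone_weierstrass R K L f cK cf _ _ _ _ _ _ eps0.
- by exists (gelfand 0), 0 => //; exact: Ae0.
- by move=> g [x ax ->]; exact: gelfand_continuous.
- move=> g h [x ax ->] [y ay ->]; exists (join x y); first exact: Ae_join.
  by apply/funext => k; rewrite gelfandJ.
- move=> g h [x ax ->] [y ay ->]; exists (meet x y); first exact: Ae_meet.
  by apply/funext => k; rewrite gelfand_meet.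
- move=> s t; have [[y [ay yst]]|nsep] :=
    pselect (exists y, Ae y /\ gelfand y s <> gelfand y t).
    have d0 : gelfand y s - gelfand y t != 0 by rewrite subr_eq0; apply/eqP.
    (* When [y] separates the points, an affine function of [y] with slope [c] interpolates [f] at
       both; otherwise [s = t] and a constant suffices. *)
    pose c := (f s - f t) / (gelfand y s - gelfand y t).
    exists (gelfand (c *: y + (f t - c * gelfand y t) *: e)); split.
    + by eexists; last reflexivity; apply: AeD; [exact: AeZ|exact: AeZe].
    + rewrite gelfandD !gelfandZ gelfand_e mulr1 addrCA -mulrBr /c divfK //.
      by rewrite addrC subrK.
    + by rewrite gelfandD !gelfandZ gelfand_e mulr1 addrC subrK.
  have -> : s = t.
    apply: gelfand_inj_Ae => x ax; apply: contrapT => xst.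
    by apply: nsep; exists x.
  exists (gelfand (f t *: e)); split.
  + by eexists; last reflexivity; exact: AeZe.
  + by rewrite gelfandZ gelfand_e mulr1.
  + by rewrite gelfandZ gelfand_e mulr1.
- by exists x.
Qed.

(** Approximants converging uniformly to [f] are Cauchy in [A], since the norm is attained on [K];
    their limit lies in the closed ideal and represents [f]. *)
Lemma gelfand_surj (f : K -> R) : continuous f -> exists2 x, Ae x & gelfand x = f.
Proof.
move=> cf.
have dens (n : nat) : exists x, Ae x /\ forall k, `|gelfand x k - f k| < n.+1%:R^-1.
  have n0 : (0 : R) < n.+1%:R^-1 by rewrite invr_gt0.
  by have [x ax h] := gelfand_dense cf n0; exists x.
have {dens} [u uP] := choice dens.
have au n : Ae (u n) by case: (uP n).
have uf eps : 0 < eps ->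
    exists N, forall n k, (N <= n)%N -> `|gelfand (u n) k - f k| < eps.
  move=> /ltr_add_invr[N]; rewrite add0r => Neps; exists N => n k Nn.
  case: (uP n) => _ /(_ k) /lt_trans; apply; apply: le_lt_trans Neps.
  by rewrite lef_pV2 ?posrE // ler_nat ltnS.
case: BA => _ _ _ _ /(_ u (fun=> I))[].
  move=> eps eps0; have e2 : 0 < eps / 2 by rewrite divr_gt0.
  have [N uN] := uf _ e2; exists N => m n Nm Nn.
  have [k] := gelfand_norm_attained (AeB (au m) (au n)).
  rewrite gelfandB => /le_lt_trans; apply.
  have := uN m k Nm; have := uN n k Nn.
  by rewrite !ltr_norml => /andP[? ?] /andP[? ?]; apply/andP; split; lra.
move=> x _ ux; have ax : Ae x.
  by apply: Ae_closed => eps /ux[N uN]; exists (u N); [exact: au|exact: uN].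
exists x => //; apply/funext => k; apply/eqP; rewrite -subr_eq0 -normr_le0.
apply/ler_addgt0Pr => eps eps0; rewrite add0r.
have e2 : 0 < eps / 2 by rewrite divr_gt0.
have [[N uN] [M uM]] := (uf _ e2, ux _ e2).
pose n := maxn N M.
have := uN n k (leq_maxl _ _); have := uM n (leq_maxr _ _).
move=> /(le_lt_trans (gelfand_le_norm k (AeB (au n) ax))).
rewrite gelfandB !ltr_norml ler_norml => /andP[? ?] /andP[? ?].
by apply/andP; split; lra.
Qed.

End Representation.

Lemma Ae_CK_isometric : exists (K : topologicalType) (T : A -> K -> R),
  [/\ compact [set: K], hausdorff_space K & CK_isometric le join mul Ae norme T].
Proof.
have [P [aP PA PD PZ PJ]] := Ae_proj_exists.
have pJ := vupper_sublinear aP PD PZ PJ.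
have pE x : Ae x -> (vupper \o P) x = vupper x by move=> ax /=; rewrite PA.
have PB x y : P (x - y) = P x - P y by rewrite PD -scaleN1r PZ scaleN1r.
(* Since [P (x - P x) = 0], the companion of [x] is [P x]. *)
have pK x : exists2 a, Ae a & (vupper \o P) (x - a) <= 0 /\ (vupper \o P) (a - x) <= 0.
  exists (P x) => //=; rewrite !PB (PA _ (aP x)) subrr.
  by split; apply/(vupper_le _ Ae0); rewrite scale0r; exact: (vle_refl VL).
pose p := vupper \o P.
exists (set_type (join_spectrum join p)), (@gelfand p); split.
- exact: compact_set_type (@join_spectrum_compact R A join p).
- exact: join_spectrum_hausdorff.
- split.
  + by move=> x _; exact: gelfand_continuous.
  + by move=> f; exact: gelfand_surj.
  + move=> x y ax ay xy; apply: (vle_anti VL).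
      by apply/(gelfand_le pJ pE ax ay) => k; rewrite xy.
    by apply/(gelfand_le pJ pE ay ax) => k; rewrite xy.
  + split=> [x y _ _|c x _|x y _ _|x y ax ay|x y ax ay].
    * by apply/funext => k; exact: gelfandD.
    * by apply/funext => k; exact: gelfandZ.
    * by apply/funext => k; exact: gelfandJ.
    * exact: gelfand_le.
    * by apply/funext => k; exact: gelfandM.
  + by move=> x ax; rewrite norm_eE //; exact: gelfand_norm.
Qed.

End UnitalBanachLatticeAlgebra.

Theorem mainTheorem7 (R : realType) (A : normedModType R)
    (le : A -> A -> Prop) (join : A -> A -> A) (mul : A -> A -> A) (e : A) :
  vector_lattice le join ->
  lattice_algebra le mul ->
  BLA_on le join mul setT (fun x : A => `|x|) ->
  has_identity mul (fun x : A => `|x|) e ->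
  [/\ (* (i) *)
      BLA_on le join mul (ideal_gen le join e) (norm_e le join e) /\
      (exists (K : topologicalType) (T : A -> K -> R),
         [/\ compact [set: K], hausdorff_space K &
             CK_isometric le join mul (ideal_gen le join e)
               (norm_e le join e) T]),
      (* (ii) *)
      is_band le join (ideal_gen le join e) /\
      (forall x : A, exists! p : A * A,
         [/\ ideal_gen le join e p.1,
             disj_compl join (ideal_gen le join e) p.2 & x = p.1 + p.2]) &
      (* (iii) *)
      (forall a b : A, ideal_gen le join e a -> mul a b = e -> mul b a = e ->
         ideal_gen le join e b)].
Proof.
move=> VL LA BA IDe; split.
- by split; [exact: BLA_on_Ae|exact: Ae_CK_isometric].
- by split=> [|x]; [exact: (Ae_band VL LA BA IDe)|exact: (Ae_direct_sum VL LA BA IDe)].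
- by move=> a b; exact: (Ae_inverse_closed VL LA BA IDe).
Qed.
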